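(* Let $\Gamma=(A_i,u_i)_{i=1,2}$ be a finite two-player game. Under any solution of continuous fictitious play, the average correlated play $z(t)$ converges, as $t\to\infty$, to the reduced Hannan set $H_R$ (that is, the distance from $z(t)$ to $H_R$ tends to $0$).
   Context: $\Gamma=(A_i,u_i)_{i=1,2}$: $A_i$ is the finite action set of player $i$, $A=A_1\times A_2$, $u_i:A\to\mathbb R$ is the payoff function, extended (multi)linearly to distributions; $-i$ denotes the opponent of $i$; $\Delta(S)$ is the set of probability distributions on a finite set $S$. For $z\in\Delta(A)$, $z_i\in\Delta(A_i)$ denotes the marginal of $z$ for player $i$. The reduced Hannan set is $H_R=\{z\in\Delta(A): \max_{k\in A_i}u_i(k,z_{-i})=u_i(z)\text{ for each }i=1,2\}$. Let $BR_i(x_{-i})=\{x_i\in\Delta(A_i): u_i(x_i,x_{-i})=\max_{k\in A_i}u_i(k,x_{-i})\}$ and $BR(x)=BR_1(x_2)\times BR_2(x_1)$. An absolutely continuous function $x:[1,\infty)\to\Delta(A_1)\times\Delta(A_2)$ is a solution of continuous fictitious play if for almost all $t\ge1$, $x$ is differentiable at $t$ and $\dot x(t)=\frac1t(q(t)-x(t))$ with $q(t)=(q_1(t),q_2(t))\in BR(x(t))$. The associated average correlated play is $z(t)=\frac1t\big(z(1)+\int_1^t\bar q(\tau)\,d\tau\big)\in\Delta(A)$, where $\bar q(\tau)=q_1(\tau)\otimes q_2(\tau)\in\Delta(A)$ is the product distribution and $z(1)\in\Delta(A)$ is any initial condition with marginals $z_i(1)=x_i(1)$, $i=1,2$. *)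

(* Defs.v *)
From mathcomp Require Import all_boot all_order all_algebra.
From mathcomp Require Import all_classical all_reals all_analysis.

Set Implicit Arguments.
Unset Strict Implicit.
Unset Printing Implicit Defensive.
Import Order.TTheory GRing.Theory Num.Theory.
Import numFieldNormedType.Exports.

Local Open Scope classical_set_scope.
Local Open Scope ring_scope.

Definition simplex (R : realType) (S : finType) : set (S -> R) :=
  [set p | (forall s, 0 <= p s) /\ \sum_s p s = 1].
Arguments simplex : clear implicits.

Definition pure (R : realType) (S : finType) (k : S) : S -> R :=
  fun s => (s == k)%:R.
Arguments pure {R S} k.

Section TwoPlayers.
Variables (R : realType) (A1 A2 : finType).
Implicit Types (u z : A1 * A2 -> R).

Definition prod_distr (x1 : A1 -> R) (x2 : A2 -> R) : A1 * A2 -> R := fun a => x1 a.1 * x2 a.2.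

Definition marg1 z : A1 -> R := fun a1 => \sum_a2 z (a1, a2).
Definition marg2 z : A2 -> R := fun a2 => \sum_a1 z (a1, a2).

(* Linear in [z]; on [prod_distr x1 x2] it is the bilinear extension of [u]. *)
Definition payoff u z : R := \sum_a z a * u a.

End TwoPlayers.

(* [sup] over a finite family; see [fmax_ub] and [fmax_attained]. *)
Definition fmax (R : realType) (S : finType) (f : S -> R) : R := sup (range f).

Lemma fmax_ub (R : realType) (S : finType) (f : S -> R) (k : S) :
  f k <= fmax f.
Proof.
apply: ub_le_sup; last by exists k.
exists (f [arg max_(i > k) f i]%O) => _ [j _ <-].
by case: arg_maxP => // i _; apply.
Qed.

Lemma fmax_attained (R : realType) (S : finType) (f : S -> R) (k0 : S) :
  exists k, fmax f = f k.
Proof.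
exists [arg max_(i > k0) f i]%O; apply/le_anti/andP; split; last exact: fmax_ub.
apply: ge_sup; first by exists (f k0), k0.
by move=> _ [j _ <-]; case: arg_maxP => // i _; apply.
Qed.

Section Game.
Variables (R : realType) (A1 A2 : finType).
Implicit Types (u : A1 * A2 -> R).

Definition best_replies1 u (x2 : A2 -> R) : set (A1 -> R) :=
  [set y | simplex R A1 y /\
    payoff u (prod_distr y x2) =
      fmax (fun k : A1 => payoff u (prod_distr (pure k) x2))].

Definition best_replies2 u (x1 : A1 -> R) : set (A2 -> R) :=
  [set y | simplex R A2 y /\
    payoff u (prod_distr x1 y) =
      fmax (fun k : A2 => payoff u (prod_distr x1 (pure k)))].

Definition reduced_Hannan_set u1 u2 : set (A1 * A2 -> R) :=
  [set z | [/\ simplex R (A1 * A2)%type z,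
    fmax (fun k : A1 => payoff u1 (prod_distr (pure k) (marg2 z)))
      = payoff u1 z &
    fmax (fun k : A2 => payoff u2 (prod_distr (marg1 z) (pure k)))
      = payoff u2 z]].

End Game.

Definition absolutely_continuous (R : realType) (a b : R) (f : R -> R) : Prop :=
  forall e : R, 0 < e -> exists2 d : R, 0 < d &
    forall (n : nat) (l r : 'I_n -> R),
      (forall i, a <= l i /\ l i <= r i /\ r i <= b) ->
      trivIset [set: 'I_n] (fun i => `]l i, r i[%classic) ->
      \sum_(i < n) (r i - l i) < d ->
      \sum_(i < n) `|f (r i) - f (l i)| < e.

(* On the unbounded interval [1, oo), absolute continuity is required on every
   compact subinterval; for vector-valued functions it is coordinatewise. *)
Definition absolutely_continuous_from1 (R : realType) (S : finType)
    (x : R -> S -> R) : Prop :=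
  forall (s : S) (T : R), 1 <= T ->
    absolutely_continuous 1 T (fun t => x t s).

(* Paths are total functions on [R], constrained only on [1, oo). No
   measurability of the selection [q1], [q2] is assumed: almost everywhere it
   equals [x + t x'], hence it is measurable up to a null set. *)
Definition continuous_fictitious_play (R : realType) (A1 A2 : finType)
    (u1 u2 : A1 * A2 -> R) (x1 : R -> A1 -> R) (x2 : R -> A2 -> R)
    (q1 : R -> A1 -> R) (q2 : R -> A2 -> R) : Prop :=
  [/\ (forall t, 1 <= t -> simplex R A1 (x1 t) /\ simplex R A2 (x2 t)),
      absolutely_continuous_from1 x1,
      absolutely_continuous_from1 x2 &
      {ae (@lebesgue_measure R), forall t : R, 1 <= t ->
        [/\ forall a : A1, is_derive t (1 : R) (fun s : R => x1 s a)
              (t^-1 * (q1 t a - x1 t a)),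
            forall a : A2, is_derive t (1 : R) (fun s : R => x2 s a)
              (t^-1 * (q2 t a - x2 t a)),
            best_replies1 u1 (x2 t) (q1 t) &
            best_replies2 u2 (x1 t) (q2 t)]}].

Definition average_correlated_play (R : realType) (A1 A2 : finType)
    (z1 : A1 * A2 -> R) (q1 : R -> A1 -> R) (q2 : R -> A2 -> R) (t : R) :
    A1 * A2 -> R :=
  fun a => t^-1 * (z1 a +
    \int[@lebesgue_measure R]_(s in `[1, t]) prod_distr (q1 s) (q2 s) a).

Definition eucl_dist (R : realType) (S : finType) (p q : S -> R) : R :=
  Num.sqrt (\sum_s (p s - q s) ^+ 2).

(* Extended-real valued, so that the distance to the empty set is [+oo]. *)
Definition set_dist (R : realType) (S : finType) (p : S -> R)
    (H : set (S -> R)) : \bar R :=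
  ereal_inf [set (eucl_dist p h)%:E | h in H].

(* Main.v *)
Require Import Defs.
From mathcomp Require Import all_boot all_order all_algebra.
From mathcomp Require Import all_classical all_reals all_analysis.
From mathcomp Require Import measurable_realfun ring lra.

Set Implicit Arguments.
Unset Strict Implicit.
Unset Printing Implicit Defensive.
Import Order.TTheory GRing.Theory Num.Theory.
Import numFieldNormedType.Exports.

Local Open Scope classical_set_scope.
Local Open Scope ring_scope.

(** Write Z(t) = t z(t) = z(1) + int_1^t q1 (x) q2 for the cumulative
    correlated play.  Its marginals are t x_i(t), because both sides have the
    same value at 1 and the same derivative q_i almost everywhere
    ([time_weighted_average]).  Consider, for player 1,
      F(t) = max_k u1(k, Z_2(t))   and   W(t) = u1(Z(t)).
    The maximum is attained at time t by the mixture q1(t), since q1(t) is a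
    best reply to x_2(t) and Z_2(t) is proportional to x_2(t).  The same mixture,
    kept fixed, is a lower bound of F at all other times, and its payoff
    against Z_2 has derivative u1(q1(t), q2(t)) = W'(t) at t.  Hence F - W is
    bounded below near t by its value at t up to o(|s - t|); this holds for
    almost all t, and F - W is Lipschitz, so F - W is constant ([envelope]).
    Dividing by t, the regret max_k u1(k, z_2(t)) - u1(z(t)) is c / t.  Both
    regrets tend to 0, so every cluster point of z(t) in the compact simplex
    lies in the reduced Hannan set ([cvg_reduced_Hannan_set]).

    The analytic core is [ae_stationary_constant]: an absolutely continuous
    function with f s >= f t - o(|s - t|) at almost every t is constant.  It
    serves both for the marginals and for the envelope, and the one-sided form
    of its hypothesis avoids having to prove that the maximum F is
    differentiable.  Its proof encloses the exceptional null set in an open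
    set U of small measure, on which absolute continuity makes the variation
    of f small.

    The selection q may fail to be measurable, but it agrees almost everywhere
    with a Borel function, since x' is a limit of difference quotients
    ([strategy_measurable]), and the integral does not see null sets even for
    non-measurable integrands ([ae_eq_integral_nonmeasurable]). *)

(** * Absolutely continuous functions and null sets *)

Section Chains.
Variable R : realType.
Implicit Types (U : set R) (a b t : R) (f : R -> R) (c : seq (R * R)).

(** The intervals are listed from right to left, so that extending a chain on
    the right is a cons and its intervals do not overlap. *)
Fixpoint chain U a t c : Prop :=
  if c is p :: c' then
    [/\ a <= p.1, p.1 <= p.2, p.2 <= t, `[p.1, p.2]%classic `<=` U &
        chain U a p.1 c']
  else True.

Definition chain_variation f c : R := \sum_(p <- c) `|f p.2 - f p.1|.

Definition variation_inside f U a t : R :=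
  sup [set chain_variation f c | c in [set c | chain U a t c]].

Lemma near_distP t (P : R -> Prop) :
  (\forall s \near t, P s) <-> exists2 d, 0 < d & forall s, `|s - t| < d -> P s.
Proof.
split=> [/nbhs_ballP[d d0 hd]|[d d0 hd]].
  by exists d => // s sd; apply: hd; rewrite /ball /= distrC.
by apply/nbhs_ballP; exists d => // s sd; apply: hd; rewrite distrC.
Qed.

Lemma chainS U a s t c : s <= t -> chain U a s c -> chain U a t c.
Proof. by case: c => //= p c st [? ? ps ? ?]; split => //; exact: le_trans ps st. Qed.

Lemma chain_nth U a t c i : chain U a t c -> (i < size c)%N ->
  [/\ a <= (nth (0, 0) c i).1, (nth (0, 0) c i).1 <= (nth (0, 0) c i).2 &
      (nth (0, 0) c i).2 <= t].
Proof.
elim: c t i => // p c IH t [|i] /= [h1 h2 h3 _ hc] ic; first by split.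
by have [? ? h] := IH _ _ hc ic; split => //; lra.
Qed.

Lemma chain_sorted U a t c i j : chain U a t c -> (i < j)%N -> (j < size c)%N ->
  (nth (0, 0) c j).2 <= (nth (0, 0) c i).1.
Proof.
elim: c t i j => // p c IH t [|i] [|j] //= [h1 h2 h3 _ hc] ij jc.
  by have [] := chain_nth hc jc.
exact: (IH p.1 i j hc ij jc).
Qed.

(** The intervals are disjoint up to endpoints and lie in [U]; the half-line
    on the right-hand side lets the induction peel off the last interval. *)
Lemma chain_length U a t c : measurable U -> chain U a t c ->
  ((\sum_(p <- c) (p.2 - p.1))%:E <=
   (@lebesgue_measure R) (U `&` `]-oo, t]%classic))%E.
Proof.
move=> mU; elim: c t => [|[l r] c IH] t /=; first by rewrite big_nil.
move=> [al lr rt lrU /IH {}IH]; rewrite big_cons /= EFinD.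
have -> : ((r - l)%:E = (@lebesgue_measure R) `]l, r]%classic)%E.
  rewrite lebesgue_measure_itv /= lte_fin; case: ltP => [//|rl].
  by have -> : r = l; [lra|rewrite subrr].
apply: le_trans (leeD2l _ IH) _.
rewrite -measureU//; last 2 first.
- exact: measurableI.
- rewrite -subset0 => s /= [+ [_]]; rewrite !in_itv /= => /andP[ls _].
  by move=> sl; move: (lt_le_trans ls sl); rewrite ltxx.
apply: le_measure; rewrite ?inE.
- by apply: measurableU => //; exact: measurableI.
- exact: measurableI.
move=> s /= [|[Us]]; rewrite !in_itv /=.
  move=> /andP[ls sr]; split; last exact: le_trans sr rt.
  by apply: lrU; rewrite /= in_itv /= (ltW ls).
by move=> sl; split => //; rewrite (le_trans sl)// (le_trans lr).
Qed.

(** This turns the epsilon-delta clause of absolute continuity, stated for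
    indexed families of disjoint intervals, into one for chains in a set of
    measure less than [d]. *)
Lemma chain_variation_lt f U a b (d e : R) :
    (forall (n : nat) (l r : 'I_n -> R),
      (forall i, a <= l i /\ l i <= r i /\ r i <= b) ->
      trivIset [set: 'I_n] (fun i => `]l i, r i[%classic) ->
      \sum_(i < n) (r i - l i) < d ->
      \sum_(i < n) `|f (r i) - f (l i)| < e) ->
    measurable U -> ((@lebesgue_measure R) U < d%:E)%E ->
  forall c, chain U a b c -> chain_variation f c < e.
Proof.
move=> acf mU mUd c hc.
have lt_d : \sum_(p <- c) (p.2 - p.1) < d.
  rewrite -lte_fin; apply: le_lt_trans mUd; apply: le_trans (chain_length mU hc) _.
  apply: le_measure; rewrite ?inE//; exact: measurableI.
rewrite /chain_variation (big_nth (0, 0)) big_mkord.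
apply: (acf _ (fun i : 'I_(size c) => (nth (0, 0) c i).1)
              (fun i : 'I_(size c) => (nth (0, 0) c i).2)).
- by move=> i; have [] := chain_nth hc (ltn_ord i).
- move=> i j _ _ [s /= []]; rewrite !in_itv /= => /andP[si is_] /andP[sj js].
  apply/val_inj/eqP => /=; rewrite eqn_leq; apply/andP; split; rewrite leqNgt;
    apply/negP => ij.
    have := chain_sorted hc ij (ltn_ord i); lra.
  have := chain_sorted hc ij (ltn_ord j); lra.
- by rewrite (big_nth (0, 0)) big_mkord in lt_d.
Qed.

(** A chain up to [t] is also a chain up to [s], and it can be extended by
    [[t, s]] when that interval lies in [U]. *)
Lemma variation_inside_step f U a t s e :
    (forall c, chain U a s c -> chain_variation f c <= e) ->
    a <= t -> t <= s ->
    (`[t, s]%classic `<=` U ->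
      `|f s - f t| + variation_inside f U a t <= variation_inside f U a s) /\
    variation_inside f U a t <= variation_inside f U a s.
Proof.
move=> he at_ ts.
have ub c : chain U a s c -> chain_variation f c <= variation_inside f U a s.
  move=> hc; apply: ub_le_sup; last by exists c.
  by exists e => _ [c' hc' <-]; exact: he.
have ne : [set chain_variation f c | c in [set c | chain U a t c]] !=set0.
  by exists (chain_variation f [::]), [::].
split.
  move=> tsU; rewrite -lerBrDl; apply: ge_sup => // _ [c hc <-].
  rewrite lerBrDl; have /ub : chain U a s ((t, s) :: c) by split.
  by rewrite /chain_variation big_cons.
by apply: ge_sup => // _ [c hc <-]; apply: ub; exact: chainS hc.
Qed.

Lemma variation_inside_bounds f U a t e :
  (forall c, chain U a t c -> chain_variation f c <= e) ->
  0 <= variation_inside f U a t <= e.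
Proof.
move=> he; have -> : 0 = chain_variation f [::] by rewrite /chain_variation big_nil.
apply/andP; split.
  by apply: ub_le_sup; [exists e => _ [c hc <-]; exact: he|exists [::]].
by apply: ge_sup; [exists (chain_variation f [::]), [::]|move=> _ [c hc <-]; exact: he].
Qed.

(** Growth lemma.  Off [U] the lower slope of [f] is at least [- e]; inside
    [U] the decrease of [f] is compensated by the increase of [V].  Let [T] be
    the supremum of the points up to which the inequality holds.  By continuity
    it holds at [T], and if [T < b] it persists a little to the right of [T], by
    the hypothesis on [U] or by the one off [U].  Only the behaviour to the
    right of each point matters, which is why the reflected function gives the
    reverse inequality in [ae_stationary_constant]. *)
Lemma growth_up_to_variation (f V : R -> R) (U : set R) (a b e : R) :
    a <= b -> 0 < e -> open U ->
    (forall s t, a <= s -> s <= t -> t <= b -> V s <= V t) ->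
    (forall s t, a <= s -> s <= t -> t <= b -> `[s, t]%classic `<=` U ->
       f s - f t <= V t - V s) ->
    (forall t (n : R), a <= t <= b -> 0 < n ->
       \forall s \near t, a <= s <= b -> `|f s - f t| <= n) ->
    (forall t, a <= t <= b -> ~ U t ->
       \forall s \near t, f t - e * `|s - t| <= f s) ->
  f a <= f b + (V b - V a) + e * (b - a).
Proof.
move=> ab e0 oU Vnd VU fc fN.
pose S := [set t | a <= t <= b /\ f a <= f t + (V t - V a) + e * (t - a)].
have Sa : S a by rewrite /S /= lexx ab !subrr; split => //; lra.
have supS : has_sup S.
  by split; [exists a|exists b => t [/andP[_ tb] _]].
set T := sup S.
have aT : a <= T by apply: ub_le_sup => //; exact: supS.2.
have Tb : T <= b by apply: ge_sup; [exact: supS.1|move=> t [/andP[]]].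
have ST : S T.
  split; first by rewrite aT Tb.
  apply/ler_addgt0Pr => n n0.
  have /near_distP[d d0 hd] := fc T n (introT andP (conj aT Tb)) n0.
  have [s [sab hs] sT] := sup_adherent d0 supS.
  have sleT : s <= T by apply: ub_le_sup => //; exact: supS.2.
  have : `|f s - f T| <= n.
    apply: hd => //; rewrite -/T in sT; rewrite ler0_norm; lra.
  rewrite ler_norml => /andP[_ h].
  have /andP[as_ _] := sab; have h2 := Vnd s T as_ sleT Tb.
  have : e * (s - a) <= e * (T - a) by rewrite ler_pM2l//; lra.
  lra.
have [Tltb|bleT] := ltP T b; last first.
  have -> : b = T by lra.
  exact: ST.2.
exfalso.
suff [s [Ts sb hs]] : exists s, [/\ T < s, s <= b &
    f T <= f s + (V s - V T) + e * (s - T)].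
  have : s <= T.
    apply: ub_le_sup; first exact: supS.2.
    split; first by apply/andP; split; lra.
    by have := ST.2; lra.
  lra.
have [UT|nUT] := pselect (U T).
  have /near_distP[d d0 hd] := open_nbhs_nbhs (conj oU UT).
  exists (Num.min b (T + d / 2)).
  have h1 : T < Num.min b (T + d / 2) by rewrite lt_min Tltb /=; lra.
  have h2 : Num.min b (T + d / 2) <= b by rewrite ge_min lexx.
  have h3 : Num.min b (T + d / 2) <= T + d / 2 by rewrite ge_min lexx orbT.
  split => //.
  have : `[T, Num.min b (T + d / 2)]%classic `<=` U.
    move=> s /=; rewrite in_itv /= => /andP[Ts sm]; apply: hd.
    rewrite ger0_norm; lra.
  move/(VU _ _ aT (ltW h1) h2).
  have : 0 <= e * (Num.min b (T + d / 2) - T) by rewrite mulr_ge0//; lra.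
  lra.
have /near_distP[d d0 hd] := fN T (introT andP (conj aT Tb)) nUT.
exists (Num.min b (T + d / 2)).
have h1 : T < Num.min b (T + d / 2) by rewrite lt_min Tltb /=; lra.
have h2 : Num.min b (T + d / 2) <= b by rewrite ge_min lexx.
have h3 : Num.min b (T + d / 2) <= T + d / 2 by rewrite ge_min lexx orbT.
split => //.
have /hd : `|Num.min b (T + d / 2) - T| < d by rewrite ger0_norm; lra.
rewrite ger0_norm; last lra.
have := Vnd _ _ aT (ltW h1) h2; lra.
Qed.

Lemma absolutely_continuous_uniform f a b (e : R) :
    absolutely_continuous a b f -> 0 < e ->
  exists2 d : R, 0 < d &
    forall s t, a <= s <= b -> a <= t <= b -> `|s - t| < d -> `|f s - f t| < e.
Proof.
move=> acf e0; have [d d0 hd] := acf e e0; exists d => // s t.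
wlog ts : s t / t <= s => [h sab tab std|/andP[as_ sb] /andP[at_ tb] std].
  have [st|/ltW st] := leP t s; first exact: h.
  by rewrite distrC; apply: h => //; rewrite distrC.
have := hd 1%N (fun=> t) (fun=> s); rewrite !big_ord1; apply => //.
  by move=> i j; rewrite !ord1.
by move: std; rewrite ger0_norm; lra.
Qed.

(** The variation of [f] inside a small open neighbourhood [U] of the
    exceptional set plays the role of [V] in the growth lemma.  The lower bound
    holds on both sides of [t], so the growth lemma applies to [f] and to
    [f \o -%R], giving both inequalities. *)
Lemma ae_stationary_constant f a b : a <= b ->
    absolutely_continuous a b f ->
    {ae (@lebesgue_measure R), forall t, a < t -> t < b ->
      forall e : R, 0 < e -> \forall s \near t, f t - e * `|s - t| <= f s} ->
  f b = f a.
Proof.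
move=> ab acf [N [mN N0 hN]].
have fc t (n : R) : a <= t <= b -> 0 < n ->
    \forall s \near t, a <= s <= b -> `|f s - f t| <= n.
  move=> tab n0; have [d d0 hd] := absolutely_continuous_uniform acf n0.
  by apply/near_distP; exists d => // s std sab; exact/ltW/hd.
(* One [e] comes from the variation inside [U], and [e * (b - a)] from the
   slope off [U]. *)
have key (e : R) : 0 < e ->
    f a <= f b + e + e * (b - a) /\ f b <= f a + e + e * (b - a).
  move=> e0; have [d d0 hd] := acf e e0.
  (* The endpoints are added because the hypothesis speaks of interior points. *)
  pose N' := N `|` ([set a] `|` [set b]).
  have mN' : measurable N' by do 2 (apply: measurableU => //).
  have N'0 : (@lebesgue_measure R) N' = 0%E.
    apply: (measure_negligible mN'); apply: negligibleU; first by exists N; split.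
    apply: negligibleU; apply/negligibleP => //; exact: lebesgue_measure_set1.
  have le0 : (@lebesgue_measure R N' <= 0)%E.
    by move/eqP: N'0; rewrite eq_le => /andP[].
  have [|U [oU N'U]] := @lebesgue_regularity_outer _ N' d mN' _ d0.
    exact: (le_lt_trans le0 (ltry 0)).
  have mU : measurable U by exact: measurable_realfun.open_measurable.
  move=> mUN.
  have mUd : (@lebesgue_measure R U < d%:E)%E.
    rewrite -[X in @lebesgue_measure R X](setDUK N'U).
    apply: le_lt_trans (measureU2 _ _ _) _ => //; first exact: measurableD.
    by apply: le_lt_trans mUN; apply: le_trans (leeD2r _ le0) _; rewrite add0e.
  have ube t c : t <= b -> chain U a t c -> chain_variation f c <= e.
    by move=> tb /(chainS tb) hc; exact/ltW/(chain_variation_lt hd mU mUd hc).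
  pose V := variation_inside f U a.
  have V0 t : t <= b -> 0 <= V t <= e.
    by move=> tb; apply: variation_inside_bounds => c; exact: ube.
  have Vstep s t : a <= s -> s <= t -> t <= b ->
      (`[s, t]%classic `<=` U -> `|f t - f s| + V s <= V t) /\ V s <= V t.
    by move=> as_ st tb; apply: (@variation_inside_step _ _ _ _ _ e) => // c; exact: ube.
  have nU t : a <= t <= b -> ~ U t ->
      \forall s \near t, f t - e * `|s - t| <= f s.
    move=> /andP[at_ tb] nUt.
    have nN't : ~ N' t by move/N'U.
    have at' : a < t.
      by rewrite lt_neqAle at_ andbT; apply/eqP => ta; apply: nN't; right; left.
    have tb' : t < b.
      by rewrite lt_neqAle tb andbT; apply/eqP => ta; apply: nN't; right; right.
    apply: contrapT => h; apply: nN't; left; apply: hN => /= h'.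
    by apply: h; exact: h'.
  have Va := V0 a ab; have Vb := V0 b (lexx b).
  split.
    have := @growth_up_to_variation f V U a b e ab e0 oU.
    have: (forall s t : R, a <= s -> s <= t -> t <= b -> V s <= V t).
      by move=> s t as_ st tb; have [] := Vstep _ _ as_ st tb.
    move=> h /(_ h) {h}.
    have: (forall s t : R, a <= s -> s <= t -> t <= b ->
        `[s, t]%classic `<=` U -> f s - f t <= V t - V s).
      move=> s t as_ st tb stU; have [/(_ stU) + _] := Vstep _ _ as_ st tb.
      by have := ler_norm (f s - f t); rewrite distrC; lra.
    move=> h /(_ h fc nU) {h}.
    lra.
  (* The second inequality: reflect [f], [U] and the increments of [V]. *)
  have := @growth_up_to_variation
    (f \o -%R) (fun t => - V (- t)) (-%R @^-1` U) (- b) (- a) e.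
  rewrite lerN2 => /(_ ab e0).
  have : open (-%R @^-1` U).
    by apply: open_comp => // ? _; exact: opp_continuous.
  move=> h /(_ h) {h}.
  have: (forall s t : R, - b <= s -> s <= t -> t <= - a -> - V (- s) <= - V (- t)).
    move=> s t bs st ta; rewrite lerN2.
    have [] := Vstep (- t) (- s) _ _ _ => //; lra.
  move=> h /(_ h) {h}.
  have: (forall s t : R, - b <= s -> s <= t -> t <= - a ->
     `[s, t]%classic `<=` -%R @^-1` U ->
     (f \o -%R) s - (f \o -%R) t <= - V (- t) - - V (- s)).
    move=> s t bs st ta stU /=.
    have h : `[- t, - s]%classic `<=` U.
      move=> r /=; rewrite in_itv /= => /andP[tr rs].
      have /stU : `[s, t]%classic (- r) by rewrite /= in_itv /=; apply/andP; split; lra.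
      by rewrite /= opprK.
    have [|||/(_ h) + _] := Vstep (- t) (- s); try lra.
    by have := ler_norm (f (- s) - f (- t)); lra.
  move=> h /(_ h) {h}.
  have : forall t n : R, - b <= t <= - a -> 0 < n ->
    \forall s \near t, - b <= s <= - a -> `|(f \o -%R) s - (f \o -%R) t| <= n.
    move=> t n /andP[bt ta] n0 /=.
    have [|d' d'0 hd'] := (near_distP _ _).1 (fc (- t) n _ n0).
      by apply/andP; split; lra.
    apply/near_distP; exists d' => // s sd /andP[bs sa]; apply: hd'.
      by rewrite -opprD normrN.
    by apply/andP; split; lra.
  move=> h /(_ h) {h}.
  have : forall t : R, - b <= t <= - a -> ~ (-%R @^-1` U) t ->
    \forall s \near t, (f \o -%R) t - e * `|s - t| <= (f \o -%R) s.
    move=> t /andP[bt ta] /= nUt.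
    have [|d' d'0 hd'] := (near_distP _ _).1 (nU (- t) _ nUt).
      by apply/andP; split; lra.
    apply/near_distP; exists d' => // s sd.
    by have := hd' (- s); rewrite -opprD normrN; apply.
  move=> h /(_ h) {h}.
  rewrite /= !opprK; lra.
have b1 : 0 < b - a + 1 by lra.
apply/eqP; rewrite eq_le; apply/andP; split; apply/ler_addgt0Pr => e e0;
  have [h1 h2] := key (e / (b - a + 1)) (divr_gt0 e0 b1);
  have : e / (b - a + 1) * (b - a + 1) = e by rewrite divfK// gt_eqF.
all: rewrite mulrDr mulr1; lra.
Qed.

End Chains.

(** * Integrals and derivatives almost everywhere *)

Section AeIntegral.
Context d (T : measurableType d) (R : realType).
Variable mu : {measure set T -> \bar R}.
Implicit Types (f g : T -> \bar R) (D : set T).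
Local Open Scope ereal_scope.

Import HBNNSimple.

(** The integral of a nonnegative function is a supremum over simple functions
    below it.  Cutting such a simple function off on the null set where [f] and
    [g] may differ makes it a simple function below [g], with the same
    integral. *)
Lemma ge0_ae_le_integral_nonmeasurable D f g :
    (forall x, D x -> 0 <= f x) -> (forall x, D x -> 0 <= g x) ->
    ae_eq mu D f g ->
  \int[mu]_(x in D) f x <= \int[mu]_(x in D) g x.
Proof.
move=> f0 g0 [N [mN N0 fgN]].
rewrite !ge0_integralE//; apply: ge_ereal_sup => _ [h /= hf <-].
pose h' := proj_nnsfun h (measurableC mN).
suff -> : sintegral mu h = sintegral mu h'.
  apply: ereal_sup_ubound; exists h' => //= x.
  rewrite /h' /= mindicE; have [xN|xN] := boolP (x \in ~` N).
    rewrite mulr1; apply: le_trans (hf x) _; rewrite !patchE.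
    case: ifPn => // /set_mem Dx; suff -> : f x = g x by [].
    move: xN; rewrite inE /= => xN; apply: contrapT => fg; apply: xN; apply: fgN => /= h1.
    by apply: fg; exact: h1.
  rewrite mulr0 patchE; case: ifPn => // /set_mem Dx; exact: g0.
have E (k : {nnsfun T >-> R}) : sintegral mu k = \int[mu]_x (k x)%:E.
  by rewrite integral_nnsfun// patch_setT.
rewrite !E; apply: ae_eq_integral => //.
- exact/measurable_EFinP.
- exact/measurable_EFinP.
exists N; split => //= x /= hx; apply: contrapT => xN; apply: hx => _.
by rewrite /= mindicE mem_set// mulr1.
Qed.

Lemma ae_eq_integral_nonmeasurable D f g : ae_eq mu D f g ->
  \int[mu]_(x in D) f x = \int[mu]_(x in D) g x.
Proof.
move=> fg; move: fg => /ae_eq_funeposneg[fgp fgn].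
have ge0_eq f' g' : (forall x, 0 <= f' x) -> (forall x, 0 <= g' x) ->
    ae_eq mu D f' g' -> \int[mu]_(x in D) f' x = \int[mu]_(x in D) g' x.
  move=> f0 g0 fg'; apply/eqP; rewrite eq_le.
  by rewrite !ge0_ae_le_integral_nonmeasurable//; exact: ae_eq_sym.
by rewrite integralE [RHS]integralE; congr (_ - _); apply: ge0_eq.
Qed.

End AeIntegral.

Section Derivatives.
Variable R : realType.
Implicit Types (f g p : R -> R) (t : R).
Notation mu := (@lebesgue_measure R).

Lemma ae_imply (P Q : R -> Prop) : {ae mu, forall t, P t} ->
  (forall t, P t -> Q t) -> {ae mu, forall t, Q t}.
Proof.
move=> hP PQ; apply: filterS hP; first exact: (ae_filter_ringOfSetsType mu).
exact: PQ.
Qed.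

Lemma ae_imply2 (P Q S : R -> Prop) : {ae mu, forall t, P t} ->
  {ae mu, forall t, Q t} -> (forall t, P t -> Q t -> S t) -> {ae mu, forall t, S t}.
Proof.
move=> hP hQ PQ; apply: filterS2 hP hQ; first exact: (ae_filter_ringOfSetsType mu).
exact: PQ.
Qed.

Lemma is_derive_near f t (l : R) : is_derive t (1 : R) f l ->
  forall e : R, 0 < e ->
    \forall s \near t, `|f s - f t - l * (s - t)| <= e * `|s - t|.
Proof.
move=> [df <-] e e0.
move: df; rewrite /derivable => /cvg_ex[/= l' dl'].
have -> : 'D_1 f t = l' by apply: cvg_lim.
move/cvgrPdist_le : dl' => /(_ _ e0) [d /= d0 hd].
apply/near_distP; exists d => // s st.
have [->|nst] := eqVneq s t; first by rewrite !subrr mulr0 subr0 normr0 mulr0.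
have nst0 : s - t != 0 by rewrite subr_eq0.
have := hd (s - t).
rewrite /ball_ /= sub0r normrN => /(_ st nst0).
rewrite [_%:A]mulr1 subrK distrC -(ler_pM2r (_ : 0 < `|s - t|)) ?normr_gt0//.
rewrite -normrM mulrBl.
by rewrite [_ *: _]mulrC mulfVK.
Qed.

(** The witness is the limsup of the difference quotients with step
    [1 / (n + 1)], which are continuous functions of [t]. *)
Lemma measurable_right_derivative f : continuous f ->
  exists2 g : R -> R, measurable_fun setT g &
    forall t l, (n.+1%:R * (f (t + n.+1%:R^-1) - f t)) @[n --> \oo] --> l -> g t = l.
Proof.
move=> cf; pose D n t := (n.+1%:R * (f (t + n.+1%:R^-1) - f t))%:E.
exists (fun t => fine (limn_esup (D ^~ t))).
  apply: (measurableT_comp (fine_measurable measurableT)).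
  apply: measurable_fun_limn_esup => n.
  apply/measurable_EFinP; apply: continuous_measurable_fun => t.
  apply: cvgM; first exact: cvg_cst.
  apply: cvgB; last exact: cf.
  apply: continuous_comp; last exact: cf.
  by apply: cvgD; [exact: cvg_id|exact: cvg_cst].
move=> t l tl; have /cvg_limn_einf_sup[_ ->] // : D ^~ t @ \oo --> l%:E.
by apply: cvg_EFin => //; exact: nearW.
Qed.

(** Paths are only constrained on [[1, +oo[]; freezing them before time 1
    gives functions that are continuous, hence measurable, on the whole
    line. *)
Lemma continuous_clamped f :
    (forall T, 1 <= T -> absolutely_continuous 1 T f) ->
  continuous (fun t => f (Num.max 1 t)).
Proof.
move=> acf.
have max1_lip (s t : R) : `|Num.max 1 s - Num.max 1 t| <= `|s - t|.
  rewrite /Num.max; case: ltP => h1; case: ltP => h2 //.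
  - rewrite !ger0_norm; lra.
  - rewrite !ler0_norm; lra.
  - by rewrite subrr normr0.
move=> t; apply/cvgrPdist_lt => e e0.
have max1_ge (s : R) : 1 <= Num.max 1 s by rewrite le_max lexx.
have T1 : 1 <= Num.max 1 t + 1 by have := max1_ge t; lra.
have [d d0 hd] := absolutely_continuous_uniform (acf _ T1) e0.
apply/near_distP; exists (Num.min d 1); first by rewrite lt_min d0 ltr01.
move=> s; rewrite lt_min => /andP[sd s1]; rewrite distrC; apply: hd.
- rewrite max1_ge /= -lerBlDl.
  by apply: le_trans (le_trans (ler_norm _) (max1_lip _ _)) (ltW s1).
- by rewrite max1_ge lerDl ler01.
- exact: le_lt_trans (max1_lip _ _) sd.
Qed.

Lemma ae_derivative_measurable f f' :
    (forall T, 1 <= T -> absolutely_continuous 1 T f) ->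
    {ae mu, forall t, 1 <= t -> is_derive t (1 : R) f (f' t)} ->
  exists2 g : R -> R, measurable_fun setT g &
    {ae mu, forall t, 1 <= t -> f' t = g t}.
Proof.
move=> acf df; pose h t := f (Num.max 1 t).
have ch : continuous h by exact: continuous_clamped.
have hf (t : R) : 1 <= t -> h t = f t by move=> t1; rewrite /h max_r.
have [g mg hg] := measurable_right_derivative ch.
exists g => //; apply: (ae_imply df) => t dft t1; apply/esym/hg.
apply/cvgrPdist_le => e e0.
have /near_distP[d d0 hd] := is_derive_near (dft t1) e0.
near=> n.
have n0 : 0 < n.+1%:R^-1 :> R by rewrite invr_gt0.
have -> : h (t + n.+1%:R^-1) = f (t + n.+1%:R^-1) by rewrite hf// ler_wpDr// ltW.
rewrite hf// distrC.
have := hd (t + n.+1%:R^-1); rewrite addrAC subrr add0r (gtr0_norm n0).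
have nd : n.+1%:R^-1 < d.
  by near: n; exact: near_infty_natSinv_lt (PosNum d0).
move=> /(_ nd); rewrite -(ler_pM2l (_ : 0 < n.+1%:R))//.
rewrite [leRHS]mulrCA mulfV ?pnatr_eq0// mulr1; apply: le_trans.
rewrite -[X in X * `|_|](@ger0_norm _ n.+1%:R)// -normrM.
by rewrite [in leRHS]mulrBr (mulrCA _ (f' t)) mulfV ?pnatr_eq0// mulr1.
Unshelve. all: by end_near.
Qed.

(** Replace [p] by its measurable version [g] and use Lebesgue
    differentiation. *)
Lemma bounded_primitive p g : measurable_fun setT g ->
    (forall t, 0 <= g t <= 1) -> {ae mu, forall t, 1 <= t -> p t = g t} ->
  let I t := \int[mu]_(s in `[1, t]) p s in
  [/\ I 1 = 0, forall s t, 1 <= s -> s <= t -> 0 <= I t - I s <= t - s &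
      {ae mu, forall t, 1 < t -> is_derive t (1 : R) I (p t)}].
Proof.
move=> mg g01 pg I.
have IE : I = fun t => \int[mu]_(s in `[1, t]) g s.
  apply/funext => t; rewrite /I /Rintegral; congr fine.
  apply: ae_eq_integral_nonmeasurable.
  apply: (ae_imply pg) => s h /=; rewrite in_itv /= => /andP[s1 _].
  by rewrite h.
have gb (A : set R) : [bounded g x | x in A].
  exists 1; split => // M M1 x Ax /=; have /andP[g0 g1] := g01 x.
  rewrite ger0_norm//; lra.
have ig (A : set R) : measurable A -> (mu A < +oo)%E ->
    mu.-integrable A (EFin \o g).
  move=> mA Aoo; apply: measurable_bounded_integrable => //.
  exact: measurable_funS mg.
have muI (x y : bool) (a b : R) :
    (mu [set` Interval (BSide x a) (BSide y b)] < +oo)%E.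
  rewrite lebesgue_measure_itv /=; case: ifP => _; last exact: ltry.
  by rewrite -EFinB ltry.
split.
- by rewrite /I set_itv1 Rintegral_set1.
- move=> s t s1 st; rewrite IE.
  rewrite Rintegral_itvB ?bnd_simp//; last exact: ig.
  apply/andP; split; first by apply: Rintegral_ge0 => x _; have /andP[] := g01 x.
  have -> : t - s = \int[mu]_(x in `]s, t]) 1.
    have E : t - s = fine (mu `]s, t]%classic).
      by rewrite lebesgue_measure_itv /= lte_fin; case: ltP => //= ts; lra.
    by rewrite Rintegral_cst// mul1r.
  apply: le_Rintegral => //; first exact: ig.
    apply: (@measurable_bounded_integrable _ _ _ mu (cst 1)) => //; first exact: muI.
    exists 1; split => // M M1 x Ax /=; rewrite normr1; exact: ltW.
  by move=> x _; have /andP[] := g01 x.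
- have := @FTC1 R g (BLeft 1); rewrite /= -IE.
  have ig1 (y : R) : mu.-integrable `[1, y] (EFin \o g) by exact: ig.
  have lg : locally_integrable setT g.
    split => //; first exact: openT.
    move=> K _ cK; have mK := compact_measurable cK.
    by have /integrableP[_] := ig K mK (compact_finite_measure cK).
  move=> h; have {h} := h ig1 lg.
  move=> h; apply: (ae_imply2 pg h) => t pgt {}h t1; rewrite (pgt (ltW t1)).
  have [|dI <-] := h; first by rewrite lte_fin.
  by rewrite derive1E; exact: derivableP.
Qed.

End Derivatives.

Section AbsoluteContinuity.
Variable R : realType.
Notation mu := (@lebesgue_measure R).

Lemma is_derive_lincomb (I : finType) (c : I -> R) (f : I -> R -> R)
    (l : I -> R) (t : R) :
    (forall i, is_derive t (1 : R) (f i) (l i)) ->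
  is_derive t (1 : R) (fun s => \sum_i c i * f i s) (\sum_i c i * l i).
Proof.
move=> fl; elim: (index_enum I) => [|i r IH].
  by rewrite big_nil; under eq_fun do rewrite big_nil; exact: is_derive_cst.
rewrite big_cons; under eq_fun do rewrite big_cons.
have := is_deriveD (is_deriveZ (c i) (fl i)) IH; exact.
Qed.

Lemma dominated_absolutely_continuous (f g : R -> R) (a b C : R) :
    0 < C -> absolutely_continuous a b g ->
    (forall s t : R, a <= s -> s <= t -> t <= b ->
       `|f t - f s| <= C * (`|g t - g s| + (t - s))) ->
  absolutely_continuous a b f.
Proof.
move=> C0 acg fg e e0; have eC : 0 < e / C / 2 by rewrite !divr_gt0.
have [d d0 hd] := acg _ eC.
exists (Num.min d (e / C / 2)); first by rewrite lt_min d0.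
move=> n l r lr tI; rewrite lt_min => /andP[sd se].
have h := hd n l r lr tI sd.
apply: (@le_lt_trans _ _
  (C * (\sum_(i < n) `|g (r i) - g (l i)| + \sum_(i < n) (r i - l i)))).
  rewrite -big_split mulr_sumr; apply: ler_sum => i _.
  by have [? [? ?]] := lr i; exact: fg.
rewrite -ltr_pdivlMl// mulrC [ltRHS](splitr); exact: ltrD.
Qed.

Lemma lipschitz_absolutely_continuous (f : R -> R) (a b C : R) :
    (forall s t : R, a <= s -> s <= t -> t <= b -> `|f t - f s| <= C * (t - s)) ->
  absolutely_continuous a b f.
Proof.
move=> fC; apply: (@dominated_absolutely_continuous _ (fun=> 0) _ _ (Num.max C 1)).
- by rewrite lt_max ltr01 orbT.
- move=> e e0; exists 1 => // n l r _ _ _; rewrite big1// => i _.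
  by rewrite subrr normr0.
- move=> s t as_ st tb; rewrite subrr normr0 add0r; apply: le_trans (fC _ _ as_ st tb) _.
  by rewrite ler_wpM2r ?subr_ge0// le_max lexx.
Qed.

(** The function [t * x t - M t] is absolutely continuous with derivative
    [x t + (q t - x t) - q t = 0] almost everywhere, and it vanishes at 1. *)
Lemma time_weighted_average (x q M : R -> R) (C : R) :
    (forall t : R, 1 <= t -> 0 <= x t <= 1) ->
    (forall T, 1 <= T -> absolutely_continuous 1 T x) ->
    {ae mu, forall t : R, 1 < t -> is_derive t (1 : R) x (t^-1 * (q t - x t))} ->
    (forall s t : R, 1 <= s -> s <= t -> `|M t - M s| <= C * (t - s)) ->
    {ae mu, forall t : R, 1 < t -> is_derive t (1 : R) M (q t)} ->
    M 1 = x 1 ->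
  forall t : R, 1 <= t -> M t = t * x t.
Proof.
move=> x01 acx dx Mlip dM M1 T T1.
pose f s := s * x s - M s.
suff : f T = f 1 by rewrite /f mul1r M1 subrr => /eqP; rewrite subr_eq0 => /eqP.
apply: ae_stationary_constant => //.
  apply: (@dominated_absolutely_continuous _ x _ _ (T + 1 + `|C|)); last 2 first.
  - exact: acx.
  - move=> s t s1 st tT; rewrite /f.
    have -> : t * x t - M t - (s * x s - M s) =
      t * (x t - x s) + x s * (t - s) - (M t - M s) by ring.
    have h1 := ler_normB (t * (x t - x s) + x s * (t - s)) (M t - M s).
    have h2 := ler_normD (t * (x t - x s)) (x s * (t - s)).
    have h3 := Mlip _ _ s1 st.
    have /andP[x0 x1] := x01 s s1.
    have C1 : C * (t - s) <= `|C| * (t - s) by rewrite ler_wpM2r ?subr_ge0// ler_norm.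
    have h4 : x s * (t - s) <= 1 * (t - s) by rewrite ler_wpM2r ?subr_ge0.
    have h5 : t * `|x t - x s| <= T * `|x t - x s| by rewrite ler_wpM2r.
    move: h2; rewrite !normrM (ger0_norm (x := t)) ?(ger0_norm x0)
      ?(ger0_norm (x := t - s)); try lra.
    have h6 : 0 <= `|C| * `|x t - x s| by rewrite mulr_ge0.
    have h7 : 0 <= T * (t - s) by rewrite mulr_ge0//; lra.
    have h8 : 0 <= `|x t - x s| by [].
    lra.
  - have := normr_ge0 C; lra.
apply: (ae_imply2 dx dM) => t dxt dMt t1 tT e e0.
have d0 : is_derive t (1 : R) f 0.
  have := is_deriveB (is_deriveM (is_derive_id t (1 : R)) (dxt t1)) (dMt t1).
  have -> : id t *: (t^-1 * (q t - x t)) + x t *: 1 - q t = 0.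
    rewrite /= /GRing.scale /= mulrA mulfV ?mul1r ?mulr1 ?gt_eqF//; [ring|lra].
  exact.
have := is_derive_near d0 e0; apply: filterS => s.
by rewrite mul0r subr0 ler_norml => /andP[+ _]; lra.
Qed.

(** The dynamics give [q = x + t x'] almost everywhere, and the right-hand side
    has a measurable version; clamping it to [[0, 1]] makes the bounds hold
    everywhere without changing it where it equals a probability. *)
Lemma strategy_measurable (S : finType) (x q : R -> S -> R) :
    (forall t : R, 1 <= t -> simplex R S (x t)) ->
    absolutely_continuous_from1 x ->
    {ae mu, forall t : R, 1 <= t -> forall s,
       is_derive t (1 : R) (fun r => x r s) (t^-1 * (q t s - x t s))} ->
    {ae mu, forall t : R, 1 <= t -> simplex R S (q t)} ->
  forall s, exists2 g : R -> R, measurable_fun setT g &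
    (forall t, 0 <= g t <= 1) /\ {ae mu, forall t : R, 1 <= t -> q t s = g t}.
Proof.
move=> xs acx dx qs s.
have [g0 mg0 hg0] : exists2 g : R -> R, measurable_fun setT g &
    {ae mu, forall t : R, 1 <= t -> t^-1 * (q t s - x t s) = g t}.
  apply: (ae_derivative_measurable (acx s)).
  by apply: (ae_imply dx) => t h t1; exact: h.
pose g t := Num.max 0 (Num.min 1 (t * g0 t + x (Num.max 1 t) s)).
exists g.
  apply: measurable_maxr => //; apply: measurable_minr => //.
  apply: measurable_funD; first exact: measurable_funM.
  exact: continuous_measurable_fun (continuous_clamped (acx s)).
split=> [t|]; first by rewrite /g le_max lexx ge_max ler01 /= ge_min lexx.
apply: (ae_imply2 hg0 qs) => t h qt t1; rewrite /g -(h t1).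
have t0 : t != 0 by rewrite gt_eqF//; lra.
rewrite (max_r t1) mulrA mulfV// mul1r subrK.
have [q0 q1] := qt t1.
have q1' : q t s <= 1 by rewrite -q1 (bigD1 s)//= lerDl sumr_ge0.
by rewrite min_r// max_r.
Qed.

End AbsoluteContinuity.

(** * Finite maxima and bilinear payoffs *)

Section Fmax.
Variables (R : realType) (S : finType).
Implicit Types f g : S -> R.

Lemma fmax_leD (k0 : S) f g (c : R) :
  (forall k, f k <= g k + c) -> fmax f <= fmax g + c.
Proof.
move=> fg; have [k ->] := fmax_attained f k0.
by apply: le_trans (fg k) _; rewrite lerD2r fmax_ub.
Qed.

Lemma fmax_scale (k0 : S) f (c : R) : 0 <= c -> fmax (fun k => c * f k) = c * fmax f.
Proof.
move=> c0; apply/le_anti/andP; split.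
  have [k ->] := fmax_attained (fun k => c * f k) k0.
  by rewrite ler_wpM2l// fmax_ub.
have [k ->] := fmax_attained f k0.
exact: (fmax_ub (fun k => c * f k)).
Qed.

Lemma cvg_fmax (k0 : S) {T : Type} {F : set_system T} {FF : Filter F}
    (f : T -> S -> R) (l : S -> R) :
    (forall k, f t k @[t --> F] --> l k) -> fmax (f t) @[t --> F] --> fmax l.
Proof.
move=> fl; apply/cvgrPdist_le => e e0.
have : \forall t \near F, forall k, `|l k - f t k| <= e.
  by apply: filter_forall => k; move/cvgrPdist_le : (fl k); apply.
apply: filterS => t h; rewrite ler_distlC; apply/andP; split.
  rewrite lerBlDr; apply: (fmax_leD k0) => k.
  by have := h k; rewrite ler_distlC lerBlDr => /andP[].
apply: (fmax_leD k0) => k.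
by have := h k; rewrite ler_distlC => /andP[].
Qed.

End Fmax.

Section Payoffs.
Variables (R : realType) (A1 A2 : finType).

(** Both sides are the payoff of player 1 when switching to [y] against the
    opponent's marginal.  On the right it is a combination of fixed linear
    functionals of [z], so that it can be differentiated along a path. *)
Lemma payoff_mix1 (u z : A1 * A2 -> R) (y : A1 -> R) :
  payoff u (prod_distr y (marg2 z)) = \sum_k y k * payoff (fun b => u (k, b.2)) z.
Proof.
rewrite /payoff /prod_distr /marg2.
rewrite (eq_bigr (fun a => y a.1 * (\sum_i z (i, a.2)) * u (a.1, a.2))); last by case.
rewrite -(pair_bigA _ (fun k j => y k * (\sum_i z (i, j)) * u (k, j))) /=.
apply: eq_bigr => k _.
rewrite (eq_bigr (fun a => z (a.1, a.2) * u (k, a.2))); last by case.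
rewrite -(pair_bigA _ (fun i j => z (i, j) * u (k, j))) /= exchange_big /= mulr_sumr.
by apply: eq_bigr => j _; rewrite -mulrA mulr_suml.
Qed.

Lemma payoff_mix2 (u z : A1 * A2 -> R) (y : A2 -> R) :
  payoff u (prod_distr (marg1 z) y) = \sum_k y k * payoff (fun b => u (b.1, k)) z.
Proof.
rewrite /payoff /prod_distr /marg1.
rewrite (eq_bigr (fun a => (\sum_j z (a.1, j)) * y a.2 * u (a.1, a.2))); last by case.
rewrite -(pair_bigA _ (fun i k => (\sum_j z (i, j)) * y k * u (i, k))) /= exchange_big /=.
apply: eq_bigr => k _.
rewrite (eq_bigr (fun a => z (a.1, a.2) * u (a.1, k))); last by case.
rewrite -(pair_bigA _ (fun i j => z (i, j) * u (i, k))) /= mulr_sumr.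
by apply: eq_bigr => i _; rewrite mulrAC mulrC -mulr_suml.
Qed.

Lemma sum_pure (S : finType) (k : S) (f : S -> R) : \sum_s pure k s * f s = f k.
Proof.
rewrite (bigD1 k)//= /pure eqxx mul1r big1 ?addr0// => s /negbTE sk.
by rewrite sk mul0r.
Qed.

Lemma payoff_pure1 (u z : A1 * A2 -> R) k :
  payoff u (prod_distr (pure k) (marg2 z)) = payoff (fun b => u (k, b.2)) z.
Proof. by rewrite payoff_mix1 sum_pure. Qed.

Lemma payoff_pure2 (u z : A1 * A2 -> R) k :
  payoff u (prod_distr (marg1 z) (pure k)) = payoff (fun b => u (b.1, k)) z.
Proof. by rewrite payoff_mix2 sum_pure. Qed.

Lemma payoff_lipschitz (w : A1 * A2 -> R) (Z : R -> A1 * A2 -> R) (s t : R) :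
    (forall a, `|Z t a - Z s a| <= t - s) ->
  `|payoff w (Z t) - payoff w (Z s)| <= (\sum_a `|w a|) * (t - s).
Proof.
move=> Zl; rewrite /payoff -sumrB mulr_suml.
apply: le_trans (ler_norm_sum _ _ _) _; apply: ler_sum => a _.
by rewrite -mulrBl normrM mulrC ler_wpM2l.
Qed.

End Payoffs.

(** * The envelope theorem for cumulative payoffs *)

Section Envelope.
Variable R : realType.
Notation mu := (@lebesgue_measure R).

(** The weights [y] chosen at time [t] attain the maximum at [t] and bound it
    from below at every [s].  With [y] fixed, the lower bound of [gap] is a
    linear combination of the coordinates of [Z] whose derivative at [t] is 0. *)
Lemma envelope (A1 A2 S : finType) (v : S -> A1 * A2 -> R) (u : A1 * A2 -> R)
    (Z p : R -> A1 * A2 -> R) (k0 : S) :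
    (forall a s t, 1 <= s -> s <= t -> `|Z t a - Z s a| <= t - s) ->
    {ae mu, forall t : R, 1 < t -> forall a, is_derive t (1 : R) (Z^~ a) (p t a)} ->
    {ae mu, forall t : R, 1 < t -> exists y : S -> R, [/\ simplex R S y,
       \sum_k y k * payoff (v k) (Z t) = fmax (fun k => payoff (v k) (Z t)) &
       \sum_k y k * payoff (v k) (p t) = payoff u (p t)]} ->
  let gap t := fmax (fun k => payoff (v k) (Z t)) - payoff u (Z t) in
  forall t : R, 1 <= t -> gap t = gap 1.
Proof.
move=> Zl dZ br gap T T1.
pose L := \sum_k \sum_a `|v k a|.
have vL k : \sum_a `|v k a| <= L.
  by rewrite /L (bigD1 k)//= lerDl sumr_ge0// => *; rewrite sumr_ge0.
apply: ae_stationary_constant => //.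
  apply: (lipschitz_absolutely_continuous (C := L + \sum_a `|u a|)) => s t s1 st _.
  have hv k : `|payoff (v k) (Z t) - payoff (v k) (Z s)| <= L * (t - s).
    apply: le_trans (payoff_lipschitz _ _) _; first by move=> a; exact: Zl.
    by rewrite ler_wpM2r ?subr_ge0.
  have hu : `|payoff u (Z t) - payoff u (Z s)| <= (\sum_a `|u a|) * (t - s).
    by apply: payoff_lipschitz => a; exact: Zl.
  have h1 : fmax (fun k => payoff (v k) (Z t)) <=
      fmax (fun k => payoff (v k) (Z s)) + L * (t - s).
    by apply: (fmax_leD k0) => k; have := hv k; rewrite ler_norml => /andP[_]; lra.
  have h2 : fmax (fun k => payoff (v k) (Z s)) <=
      fmax (fun k => payoff (v k) (Z t)) + L * (t - s).
    by apply: (fmax_leD k0) => k; have := hv k; rewrite ler_norml => /andP[+ _]; lra.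
  rewrite /gap ler_norml; move: hu; rewrite ler_norml => /andP[h3 h4].
  by apply/andP; split; lra.
apply: (ae_imply2 dZ br) => t dZt brt t1 _ e e0.
have [y [[y0 y1] yt yp]] := brt t1.
(* [w] is the functional whose value along [Z] is the lower bound of [gap]. *)
pose w a := \sum_k y k * v k a - u a.
have wE (z : A1 * A2 -> R) :
    \sum_a w a * z a = \sum_k y k * payoff (v k) z - payoff u z.
  rewrite /w /payoff; under eq_bigr do rewrite mulrBl mulr_suml.
  rewrite sumrB; congr (_ - _); last by apply: eq_bigr => a _; rewrite mulrC.
  rewrite exchange_big /=; apply: eq_bigr => k _; rewrite mulr_sumr.
  by apply: eq_bigr => a _; rewrite -mulrA (mulrC (v k a)).
have := is_derive_lincomb w (dZt t1); rewrite wE yp subrr => /is_derive_near /(_ e e0).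
apply: filterS => s; rewrite mul0r subr0 !wE yt ler_norml => /andP[h _].
have : \sum_k y k * payoff (v k) (Z s) <= fmax (fun k => payoff (v k) (Z s)).
  rewrite -[leRHS]mul1r -y1 mulr_suml; apply: ler_sum => k _.
  by rewrite ler_wpM2l// (fmax_ub (fun k => payoff (v k) (Z s))).
by rewrite /gap; lra.
Qed.

End Envelope.

(** * Vanishing regrets and convergence to the reduced Hannan set *)

Section Compactness.
Variable R : realType.

(** A cluster point of an ultrafilter is a limit; working coordinatewise avoids
    a topology on the space of correlated strategies. *)
Lemma ultra_segment_cvg (T : Type) (G : set_system T) (f : T -> R) (a b : R) :
    UltraFilter G -> (\forall t \near G, a <= f t <= b) ->
  exists p, f t @[t --> G] --> (p : R).
Proof.
move=> UG fab.
have [|p [_ clp]] := @segment_compact R a b (f @ G) _.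
  by apply: filterS fab => t; rewrite /= in_itv.
exists p => V pV /=; have [//|nV] := @in_ultra_setVsetC _ G (f @^-1` V) UG.
have [x [Vx nVx]] := clp (~` V) V nV pV.
by [].
Qed.

Variables (A1 A2 : finType) (u1 u2 : A1 * A2 -> R).
Implicit Types z : R -> A1 * A2 -> R.

Lemma cvg_finsum (I : finType) (T : Type) (F : set_system T) (FF : Filter F)
    (f : I -> T -> R) (l : I -> R) :
  (forall i, f i t @[t --> F] --> l i) ->
  (\sum_i f i t) @[t --> F] --> \sum_i l i.
Proof.
move=> fl; elim: (index_enum I) => [|i r IH].
  rewrite big_nil; under eq_fun do rewrite big_nil; exact: cvg_cst.
rewrite big_cons; under eq_fun do rewrite big_cons; exact: cvgD.
Qed.

(** If [z t] stayed at distance more than [e] from the set along a cofinal set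
    [B] of times, an ultrafilter [G] containing [B] and all neighbourhoods of
    infinity would give a limit [p] of [z] in each coordinate.  The regrets
    [c / t] tend to 0, so [p] lies in the reduced Hannan set, and [z t] comes
    close to [p] along [G]: a contradiction. *)
Lemma cvg_reduced_Hannan_set z (c1 c2 : R) (k1 : A1) (k2 : A2) :
    (forall t, 1 <= t -> simplex R (A1 * A2)%type (z t)) ->
    (forall t, 1 <= t ->
       fmax (fun k => payoff u1 (prod_distr (pure k) (marg2 (z t)))) - payoff u1 (z t)
       = t^-1 * c1) ->
    (forall t, 1 <= t ->
       fmax (fun k => payoff u2 (prod_distr (marg1 (z t)) (pure k))) - payoff u2 (z t)
       = t^-1 * c2) ->
  set_dist (z t) (reduced_Hannan_set u1 u2) @[t --> +oo] --> 0%E.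
Proof.
move=> zs gap1 gap2.
set H := reduced_Hannan_set u1 u2.
suff key (e : R) : 0 < e -> \forall t \near +oo, (set_dist (z t) H <= e%:E)%E.
  have dist_ge0 p : (0 <= set_dist p H)%E.
    by apply: le_ereal_inf_tmp => _ [h _ <-]; rewrite lee_fin sqrtr_ge0.
  apply/fine_cvgP; split.
    apply: filterS (key 1 ltr01) => t h; rewrite ge0_fin_numE//.
    exact: le_lt_trans h (ltry 1).
  apply/cvgrPdist_le => e e0; apply: filterS (key e e0) => t h /=.
  rewrite sub0r normrN ger0_norm ?fine_ge0// -lee_fin fineK//.
  by rewrite ge0_fin_numE//; exact: le_lt_trans h (ltry e).
move=> e0; apply: contrapT => nkey.
pose B := [set t | ~ (set_dist (z t) H <= e%:E)%E].
have FB : ProperFilter (within B (pinfty_nbhs R)).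
  apply: Build_ProperFilter => h.
  apply: nkey; move: h; rewrite /within /= => h; near=> t.
  have ht : B t -> set0 t by near: t; exact: h.
  by apply: contrapT => /ht.
have [G [UG BG]] := ultraFilterLemma FB.
have GB : G B by apply: BG; exact: withinT.
have Goo : pinfty_nbhs R `<=` G by move=> V VF; apply: BG; apply: filterS VF => t Vt _.
have PG : ProperFilter G by exact: ultra_proper.
have G1 : \forall t \near G, 1 <= t by apply: Goo; exact: nbhs_pinfty_ge.
have cz a : exists p, z t a @[t --> G] --> (p : R).
  apply: (@ultra_segment_cvg _ G _ 0 1) => //.
  apply: filterS G1 => t /zs[z0 z1]; rewrite z0 -z1 (bigD1 a)//= lerDl.
  by apply: sumr_ge0 => *; exact: z0.
have [p zp] := choice cz.
have cpayoff w : payoff w (z t) @[t --> G] --> payoff w p.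
  by apply: cvg_finsum => a; apply: cvgM; [exact: zp|exact: cvg_cst].
have tV (c : R) : t^-1 * c @[t --> G] --> (0 : R).
  apply: cvg_trans (_ : t^-1 * c @[t --> +oo] --> 0).
    by move=> V /Goo.
  rewrite -[X in _ --> X](mul0r c); apply: cvgM; last exact: cvg_cst.
  by apply/(@gtr0_cvgV0 _ _ _ _ id) => //; exact: nbhs_pinfty_gt.
have eqlim (f g : R -> R) (l l' : R) : (forall t, 1 <= t -> f t = g t) ->
    f t @[t --> G] --> l -> g t @[t --> G] --> l' -> l = l'.
  move=> fg fl gl; apply: (@cvg_unique _ (@Rhausdorff R) (f @ G)) => //.
  apply: cvg_trans gl; apply: near_eq_cvg.
  by apply: filterS G1 => t t1; rewrite fg.
have Hp : H p.
  split.
  - split.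
      move=> a; apply: cvgr_to_ge (zp a) _.
      by apply: filterS G1 => t /zs[].
    apply: (eqlim (fun t => \sum_a z t a) (fun=> 1)); last exact: cvg_cst.
      by move=> t /zs[].
    exact: cvg_finsum.
  - apply/eqP; rewrite -subr_eq0; apply/eqP/(eqlim _ _ _ _ gap1 _ (tV c1)).
    apply: cvgB => //; apply: (cvg_fmax k1) => k.
    rewrite payoff_pure1; under eq_fun do rewrite payoff_pure1; exact: cpayoff.
  - apply/eqP; rewrite -subr_eq0; apply/eqP/(eqlim _ _ _ _ gap2 _ (tV c2)).
    apply: cvgB => //; apply: (cvg_fmax k2) => k.
    rewrite payoff_pure2; under eq_fun do rewrite payoff_pure2; exact: cpayoff.
have cd : eucl_dist (z t) p @[t --> G] --> (0 : R).
  rewrite -[X in _ --> X]sqrtr0; apply: continuous_cvg; first exact: sqrt_continuous.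
  have E : \sum_(a : A1 * A2) (p a - p a) ^+ 2 = 0 :> R.
    by rewrite big1// => a _; rewrite subrr expr0n.
  rewrite -[X in _ --> X]E.
  apply: (@cvg_finsum _ _ G _ (fun a t => (z t a - p a) ^+ 2)) => a.
  by apply: cvgM; (apply: cvgB; [exact: zp|exact: cvg_cst]).
have Ge : \forall t \near G, eucl_dist (z t) p <= e by apply: cvgr_le cd _ e0.
have [t [Bt]] := filter_ex (filterI GB Ge).
move=> te; apply: Bt; apply: le_trans (ereal_inf_lbound _)
  (_ : (eucl_dist (z t) p)%:E <= _)%E.
  by exists p.
by rewrite lee_fin.
Unshelve. all: by end_near.
Qed.

End Compactness.

(** * Continuous fictitious play *)

Theorem proposition2 (R : realType) (A1 A2 : finType)
  (u1 u2 : A1 * A2 -> R)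
  (x1 : R -> A1 -> R) (x2 : R -> A2 -> R)
  (q1 : R -> A1 -> R) (q2 : R -> A2 -> R)
  (z1 : A1 * A2 -> R)
  (hx : continuous_fictitious_play u1 u2 x1 x2 q1 q2)
  (hz : simplex R (A1 * A2)%type z1)
  (hz_1 : marg1 z1 = x1 1) (hz_2 : marg2 z1 = x2 1) :
  set_dist (average_correlated_play z1 q1 q2 t) (reduced_Hannan_set u1 u2)
    @[t --> +oo] --> 0%E.
Proof.
have [xs ac1 ac2 dyn] := hx.
have dyn1 : {ae (@lebesgue_measure R), forall t : R, 1 <= t -> forall s,
    is_derive t (1 : R) (fun r => x1 r s) (t^-1 * (q1 t s - x1 t s))}.
  by apply: (ae_imply dyn) => t h /h[].
have dyn2 : {ae (@lebesgue_measure R), forall t : R, 1 <= t -> forall s,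
    is_derive t (1 : R) (fun r => x2 r s) (t^-1 * (q2 t s - x2 t s))}.
  by apply: (ae_imply dyn) => t h /h[].
have qs1 : {ae (@lebesgue_measure R), forall t : R, 1 <= t -> simplex R A1 (q1 t)}.
  by apply: (ae_imply dyn) => t h /h[_ _ []].
have qs2 : {ae (@lebesgue_measure R), forall t : R, 1 <= t -> simplex R A2 (q2 t)}.
  by apply: (ae_imply dyn) => t h /h[_ _ _ []].
pose p t := prod_distr (q1 t) (q2 t).
(* [Z t] is [t] times the average correlated play. *)
pose Z t a := z1 a + \int[@lebesgue_measure R]_(s in `[1, t]) p s a.
have Zprop a : [/\ Z 1 a = z1 a,
    forall s t, 1 <= s -> s <= t -> 0 <= Z t a - Z s a <= t - s &
    {ae (@lebesgue_measure R), forall t : R, 1 < t ->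
      is_derive t (1 : R) (Z^~ a) (p t a)}].
  have [g1 mg1 [g101 qg1]] :=
    strategy_measurable (fun t t1 => (xs t t1).1) ac1 dyn1 qs1 a.1.
  have [g2 mg2 [g201 qg2]] :=
    strategy_measurable (fun t t1 => (xs t t1).2) ac2 dyn2 qs2 a.2.
  have [] := @bounded_primitive R (fun s => p s a) (fun s => g1 s * g2 s).
  - exact: measurable_funM.
  - move=> t; have /andP[? ?] := g101 t; have /andP[? ?] := g201 t.
    by rewrite mulr_ge0//= mulr_ile1.
  - by apply: (ae_imply2 qg1 qg2) => t h1 h2 t1; rewrite /p /prod_distr h1// h2.
  move=> I1 Ilip Ider; split.
  - by rewrite /Z I1 addr0.
  - move=> s t s1 st; have := Ilip s t s1 st; rewrite /Z; lra.
  - apply: (ae_imply Ider) => t h /h dI.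
    have := is_deriveD (is_derive_cst (z1 a) t (1 : R)) dI; rewrite add0r; exact.
have Zlip a s t : 1 <= s -> s <= t -> `|Z t a - Z s a| <= t - s.
  move=> s1 st; have [_ /(_ _ _ s1 st)/andP[h0 h1] _] := Zprop a.
  by rewrite ger0_norm.
have dZ : {ae (@lebesgue_measure R), forall t : R, 1 < t -> forall a,
    is_derive t (1 : R) (Z^~ a) (p t a)}.
  have : {ae (@lebesgue_measure R), forall t : R, forall a, 1 < t ->
    is_derive t (1 : R) (Z^~ a) (p t a)}.
    by apply: filter_forall => a; have [] := Zprop a.
  by move=> h; apply: (ae_imply h) => t ht t1 a; exact: ht.
have Z_1 : Z 1 = z1 by apply/funext => a; have [] := Zprop a.
have simplex_le1 (S : finType) (y : S -> R) s : simplex R S y -> 0 <= y s <= 1.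
  by move=> [y0 y1]; rewrite y0 -y1 (bigD1 s)//= lerDl sumr_ge0.
have sum_lip (I : finType) (f : I -> A1 * A2) s t : 1 <= s -> s <= t ->
    `|\sum_i Z t (f i) - \sum_i Z s (f i)| <= #|I|%:R * (t - s).
  move=> s1 st; rewrite -sumrB; apply: le_trans (ler_norm_sum _ _ _) _.
  apply: le_trans (ler_sum _ (fun i _ => Zlip (f i) _ _ s1 st)) _.
  by rewrite sumr_const mulr_natl.
have sum_der (I : finType) (f : I -> A1 * A2) t l :
    (forall a, is_derive t (1 : R) (Z^~ a) (p t a)) -> \sum_i p t (f i) = l ->
    is_derive t (1 : R) (fun s => \sum_i Z s (f i)) l.
  move=> dZt <-; have := is_derive_lincomb (fun=> 1) (fun i => dZt (f i)).
  by under eq_bigr do rewrite mul1r; under eq_fun do under eq_bigr do rewrite mul1r.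
have marg1E t i : 1 <= t -> marg1 (Z t) i = t * x1 t i.
  apply: (@time_weighted_average _ (x1^~ i) (q1^~ i) (fun r => marg1 (Z r) i) #|A2|%:R).
  - by move=> r r1; apply: simplex_le1; exact: (xs r r1).1.
  - exact: ac1.
  - by apply: (ae_imply dyn1) => r h /ltW/h.
  - by move=> r s r1 rs; exact: sum_lip.
  - apply: (ae_imply2 dZ qs2) => r dZr q2r r1; apply: sum_der; first exact: dZr.
    by rewrite /p /prod_distr /= -mulr_sumr (q2r (ltW r1)).2 mulr1.
  - by rewrite Z_1 hz_1.
have marg2E t j : 1 <= t -> marg2 (Z t) j = t * x2 t j.
  apply: (@time_weighted_average _ (x2^~ j) (q2^~ j) (fun r => marg2 (Z r) j) #|A1|%:R).
  - by move=> r r1; apply: simplex_le1; exact: (xs r r1).2.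
  - exact: ac2.
  - by apply: (ae_imply dyn2) => r h /ltW/h.
  - by move=> r s r1 rs; exact: sum_lip.
  - apply: (ae_imply2 dZ qs1) => r dZr q1r r1; apply: sum_der; first exact: dZr.
    by rewrite /p /prod_distr /= -mulr_suml (q1r (ltW r1)).2 mul1r.
  - by rewrite Z_1 hz_2.
have payoffZ (w z : A1 * A2 -> R) (c : R) :
    payoff w (fun a => c * z a) = c * payoff w z.
  by rewrite /payoff mulr_sumr; apply: eq_bigr => a _; rewrite mulrA.
(* Action sets are nonempty because [z1] has total mass 1. *)
have [a0 _] : exists a0 : A1 * A2, true.
  case: (pickP (@predT (A1 * A2)%type)) => [a|none]; first by exists a.
  by have [_] := hz; rewrite big_pred0// => /eqP; rewrite eq_sym oner_eq0.
have scale1 (y : A1 -> R) (x : A2 -> R) (c : R) :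
    payoff u1 (prod_distr y (fun j => c * x j)) = c * payoff u1 (prod_distr y x).
  by rewrite -payoffZ; congr payoff; apply/funext => a; rewrite /prod_distr mulrCA.
have scale2 (x : A1 -> R) (y : A2 -> R) (c : R) :
    payoff u2 (prod_distr (fun i => c * x i) y) = c * payoff u2 (prod_distr x y).
  by rewrite -payoffZ; congr payoff; apply/funext => a; rewrite /prod_distr mulrA.
have br1 : {ae (@lebesgue_measure R), forall t : R, 1 < t -> exists y : A1 -> R,
    [/\ simplex R A1 y,
      \sum_k y k * payoff (fun b => u1 (k, b.2)) (Z t) =
        fmax (fun k => payoff (fun b => u1 (k, b.2)) (Z t)) &
      \sum_k y k * payoff (fun b => u1 (k, b.2)) (p t) = payoff u1 (p t)]}.
  apply: (ae_imply dyn) => t h t1.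
  have [_ _ [q1s br] [q2s _]] := h (ltW t1).
  exists (q1 t); split => //.
    rewrite -payoff_mix1; under eq_fun do rewrite -payoff_pure1.
    have -> : marg2 (Z t) = fun j => t * x2 t j.
      by apply/funext => j; apply: marg2E; exact: ltW.
    rewrite scale1 br -(fmax_scale a0.1)//; last by lra.
    by congr fmax; apply/funext => k; rewrite scale1.
  rewrite -payoff_mix1; congr payoff; congr prod_distr; apply/funext => j.
  by rewrite /marg2 /p /prod_distr /= -mulr_suml q1s.2 mul1r.
have br2 : {ae (@lebesgue_measure R), forall t : R, 1 < t -> exists y : A2 -> R,
    [/\ simplex R A2 y,
      \sum_k y k * payoff (fun b => u2 (b.1, k)) (Z t) =
        fmax (fun k => payoff (fun b => u2 (b.1, k)) (Z t)) &
      \sum_k y k * payoff (fun b => u2 (b.1, k)) (p t) = payoff u2 (p t)]}.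
  apply: (ae_imply dyn) => t h t1.
  have [_ _ [q1s _] [q2s br]] := h (ltW t1).
  exists (q2 t); split => //.
    rewrite -payoff_mix2; under eq_fun do rewrite -payoff_pure2.
    have -> : marg1 (Z t) = fun i => t * x1 t i.
      by apply/funext => i; apply: marg1E; exact: ltW.
    rewrite scale2 br -(fmax_scale a0.2)//; last by lra.
    by congr fmax; apply/funext => k; rewrite scale2.
  rewrite -payoff_mix2; congr payoff.
  rewrite (_ : marg1 (p t) = q1 t)//; apply/funext => i.
  by rewrite /marg1 /p /prod_distr /= -mulr_sumr q2s.2 mulr1.
have gap1 := envelope a0.1 Zlip dZ br1.
have gap2 := envelope a0.2 Zlip dZ br2.
apply: (cvg_reduced_Hannan_set a0.1 a0.2 _
  (c1 := fmax (fun k => payoff (fun b => u1 (k, b.2)) (Z 1)) - payoff u1 (Z 1))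
  (c2 := fmax (fun k => payoff (fun b => u2 (b.1, k)) (Z 1)) - payoff u2 (Z 1))) => t t1;
  have t0 : 0 < t by lra.
- split=> [a|].
    have [Za /(_ 1 t (lexx _) t1)/andP[Za0 _] _] := Zprop a.
    rewrite mulr_ge0 ?invr_ge0 ?(ltW t0)//.
    by have := hz.1 a; move: Za0; rewrite Za /Z; lra.
  rewrite -mulr_sumr.
  have -> : \sum_a (z1 a + \int[@lebesgue_measure R]_(s in `[1, t]) p s a) =
      \sum_i marg1 (Z t) i.
    by rewrite /marg1 pair_bigA /=; apply: eq_bigr => -[].
  under eq_bigr do rewrite marg1E//.
  by rewrite -mulr_sumr (xs t t1).1.2 mulr1 mulVf// gt_eqF.
- rewrite -(gap1 t t1) mulrBr -(fmax_scale a0.1) ?invr_ge0 ?(ltW t0)//.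
  congr (_ - _); last by rewrite -payoffZ.
  by congr fmax; apply/funext => k; rewrite payoff_pure1 -payoffZ.
- rewrite -(gap2 t t1) mulrBr -(fmax_scale a0.2) ?invr_ge0 ?(ltW t0)//.
  congr (_ - _); last by rewrite -payoffZ.
  by congr fmax; apply/funext => k; rewrite payoff_pure2 -payoffZ.
Qed.
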